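(* Let $m>2$, and let $L\in\mathbb{R}^{m\times m}$ be the Laplacian matrix of a connected undirected communication graph on the vertex set $\{1,\dots,m\}$, with eigenvalues $\lambda_1\le\lambda_2\le\cdots\le\lambda_m$. Let $A\in\mathbb{R}^{n\times n}$, $C_i\in\mathbb{R}^{r_i\times n}$ for $i\in\{1,\dots,m\}$, and $C=(C_1^T,\dots,C_m^T)^T$. Suppose that the (discrete-time) pair $(A,C)$ is detectable and that $$\rho(A)<\frac{\lambda_m+\lambda_2}{\lambda_m-\lambda_2},$$ where $\rho(A)$ is the spectral radius of $A$. Choose $\mathbf{W}=I_m-\alpha L$, where $\alpha>0$ satisfies $$\lambda_2^{-1}\left(1-\rho^{-1}(A)\right)<\alpha<\lambda_m^{-1}\left(1+\rho^{-1}(A)\right).$$ Then, for some $\mu_1,\dots,\mu_m\in\mathbb{Z}_+$, there exist gain parameters $\mathbf{H}_{ij}\in\mathbb{R}^{n\times r_j}$, $\mathbf{S}_{ij}\in\mathbb{R}^{n\times\mu_j}$, $\mathbf{Q}_{ij}\in\mathbb{R}^{\mu_i\times r_j}$, $\mathbf{R}_{ij}\in\mathbb{R}^{\mu_i\times\mu_j}$, $i,j\in\{1,\dots,m\}$, such that the block matrices $\mathbf{H}=(\mathbf{H}_{ij})$, $\mathbf{S}=(\mathbf{S}_{ij})$, $\mathbf{Q}=(\mathbf{Q}_{ij})$, $\mathbf{R}=(\mathbf{R}_{ij})$ satisfy the sparsity constraint $$\mathcal{P}(\mathbf{H})\le\mathcal{P}(L),\quad \mathcal{P}(\mathbf{S})\le\mathcal{P}(L),\quad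 \mathcal{P}(\mathbf{Q})\le\mathcal{P}(L),\quad \mathcal{P}(\mathbf{R})\le\mathcal{P}(L)$$ and stabilize the error dynamics $$\begin{pmatrix}\epsilon(k+1)\\ z(k+1)\end{pmatrix}=\begin{pmatrix}\mathbf{W}\otimes A-\mathbf{H}\bar{C} & -\mathbf{S}\\ \mathbf{Q}\bar{C} & \mathbf{R}\end{pmatrix}\begin{pmatrix}\epsilon(k)\\ z(k)\end{pmatrix},$$ where $\bar C$ is the block-diagonal matrix with diagonal blocks $C_1,\dots,C_m$.
   Context: Communication graph: an undirected graph whose vertices are the observers $1,\dots,m$; two observers are neighbors if they are joined by an edge. Its Laplacian $L$ is the symmetric $m\times m$ matrix with $[L]_{ij}=-1$ if $i\ne j$ and $i,j$ are neighbors, $[L]_{ii}=-\sum_{l\ne i}[L]_{il}$, and $[L]_{ij}=0$ otherwise. The graph is connected if and only if $L$ is irreducible, equivalently $\lambda_2>0$. Pattern operator: for an $m\times m$ block matrix $M$ with blocks $[M]_{ij}$, $\mathcal{P}(M)\in\{0,1\}^{m\times m}$ has $[\mathcal{P}(M)]_{ij}=0$ if the block $[M]_{ij}$ is zero and $1$ otherwise ($L$ is regarded as having scalar blocks). $\mathcal{P}(M_1)\le\mathcal{P}(M_2)$ means entrywise inequality. Background: for the LTI system $x(k+1)=Ax(k)$, $y_i(k)=C_ix(k)$, observer $i$ has state estimate $\hat x_i(k)\in\mathbb{R}^n$ and augmented state $z_i(k)\in\mathbb{R}^{\mu_i}$; $\epsilon(k)\in\mathbb{R}^{mn}$ stacks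 the errors $\epsilon_i(k)=x(k)-\hat x_i(k)$ and $z(k)$ stacks the $z_i(k)$. ''Stabilize'' means that the error-dynamics matrix has all eigenvalues in the open unit disc, so that $\epsilon(k),z(k)\to0$ for all initial conditions. $\mathbb{Z}_+$ denotes the nonnegative integers. Conventions: if $\lambda_2=\lambda_m$, the bound $\frac{\lambda_m+\lambda_2}{\lambda_m-\lambda_2}$ is $+\infty$ (no restriction on $\rho(A)$); if $\rho(A)=0$, then $\rho^{-1}(A)=+\infty$ (every $\alpha>0$ is allowed). $\rho^{-1}(A)$ means $1/\rho(A)$. $\otimes$ is the Kronecker product. *)

(* Defs.v *)
From HB Require Import structures.
From mathcomp Require Import all_boot all_order all_algebra.
From mathcomp Require Import complex mxtens.
From mathcomp Require Import all_classical all_reals all_analysis.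

Set Implicit Arguments.
Unset Strict Implicit.
Unset Printing Implicit Defensive.

Import Order.TTheory GRing.Theory Num.Theory.
Import numFieldNormedType.Exports.

Local Open Scope classical_set_scope.
Local Open Scope ring_scope.

(* Observers are indexed by 'I_m, so lambda_2 and lambda_m of an increasing
   list of eigenvalues lam are lam`_1 and lam`_m.-1. *)

(* Self-loops of e, if any, do not contribute. *)
Definition laplacian (R : realType) (m : nat) (e : rel 'I_m) : 'M[R]_m :=
  \matrix_(i, j) if i == j then \sum_(l | l != i) (e i l)%:R
                 else - (e i j)%:R.

(* lam lists the eigenvalues of M, with multiplicity, in increasing order. *)
Definition ordered_eigenvalues (R : realType) (m : nat) (M : 'M[R]_m)
    (lam : m.-tuple R) : Prop :=
  sorted <=%R lam /\ char_poly M = \prod_(x <- lam) ('X - x%:P).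

(* Complex eigenvalues of a real matrix. *)
Definition spectrum (R : realType) (n : nat) (M : 'M[R]_n) : set R[i] :=
  [set z | eigenvalue (map_mx (real_complex R) M) z].

(* The spectrum is finite, so this supremum is a maximum when n > 0; it is 0
   when n = 0. *)
Definition spectral_radius (R : realType) (n : nat) (M : 'M[R]_n) : R :=
  sup [set complex.Re `|z| | z in spectrum M].

Definition schur_stable (R : realType) (n : nat) (M : 'M[R]_n) : Prop :=
  forall z : R[i], spectrum M z -> `|z| < 1.

(* Every unobservable state (zero output at all times) decays to 0 under
   x(k+1) = A x(k). *)
Definition detectable (R : realType) (n r : nat)
    (A : 'M[R]_n) (C : 'M[R]_(r, n)) : Prop :=
  forall x : 'cV[R]_n, (forall k : nat, C *m (A ^+ k *m x) = 0) ->
    (fun k : nat => A ^+ k *m x) @ \oo --> (0 : 'cV[R]_n).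

(* A zero-dimensional block counts as a zero block. *)
Definition pattern (R : realType) (m : nat) (p q : 'I_m -> nat)
    (M : forall i j : 'I_m, 'M[R]_(p i, q j)) : 'M[nat]_m :=
  \matrix_(i, j) (M i j != 0 : nat).

Definition scalar_blocks (R : realType) (m : nat) (M : 'M[R]_m)
    (i j : 'I_m) : 'M[R]_(1, 1) := (M i j)%:M.

Definition pattern_le (m : nat) (P Q : 'M[nat]_m) : Prop :=
  forall i j : 'I_m, (P i j <= Q i j)%N.

Lemma sum_const_ord (m n : nat) : (m * n = \sum_(i < m) n)%N.
Proof. by rewrite sum_nat_const card_ord. Qed.

(* The Kronecker product W *t A has size m * n; it is recast to the size of
   an m x m block matrix with n x n blocks. *)
Definition kron (R : realType) (m n : nat) (W : 'M[R]_m) (A : 'M[R]_n) :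
    'M[R]_(\sum_(i < m) n) :=
  castmx (sum_const_ord m n, sum_const_ord m n) (W *t A).

Lemma kronE (R : realType) (m n : nat) (W : 'M[R]_m) (A : 'M[R]_n) :
  kron W A = \mxblock_(i < m, j < m) (W i j *: A).
Proof.
have E (i : 'I_m) (k : 'I_n) :
    cast_ord (esym (sum_const_ord m n)) (@tagnat.Rank m (fun=> n) i k)
      = mxtens_index (i, k).
  apply: val_inj => /=; rewrite [LHS]tagnat.RankEsum sum_nat_const.
  congr (_ * _ + _)%N; rewrite -sum1_card.
  rewrite -(big_ord_widen m (fun=> 1%N) (ltnW (ltn_ord i))).
  by rewrite sum1_card card_ord.
apply/mxblockP => i j; rewrite mxblockK; apply/matrixP => k l.
by rewrite [LHS]mxE castmxE !E tensmxE mxE.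
Qed.

(* The block-diagonal matrix diag(C_1, ..., C_m); \mxdiag only covers square
   blocks. *)
Definition block_diag (R : realType) (m n : nat) (r : 'I_m -> nat)
    (C : forall i : 'I_m, 'M[R]_(r i, n)) :
    'M[R]_(\sum_(i < m) r i, \sum_(j < m) n) :=
  \mxblock_(i < m, j < m) (if i == j then C i else 0).

Definition error_dynamics (R : realType) (m n : nat) (r mu : 'I_m -> nat)
    (W : 'M[R]_m) (A : 'M[R]_n) (C : forall i : 'I_m, 'M[R]_(r i, n))
    (H : forall i j : 'I_m, 'M[R]_(n, r j))
    (S : forall i j : 'I_m, 'M[R]_(n, mu j))
    (Q : forall i j : 'I_m, 'M[R]_(mu i, r j))
    (T : forall i j : 'I_m, 'M[R]_(mu i, mu j)) :
    'M[R]_(\sum_(i < m) n + \sum_(i < m) mu i) :=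
  block_mx
    (kron W A - (\mxblock_(i < m, j < m) H i j) *m block_diag C)
    (- \mxblock_(i < m, j < m) S i j)
    ((\mxblock_(i < m, j < m) Q i j) *m block_diag C)
    (\mxblock_(i < m, j < m) T i j).

(* Main.v *)
Require Import Defs.
From HB Require Import structures.
From mathcomp Require Import all_boot all_order all_algebra.
From mathcomp Require Import complex mxtens.
From mathcomp Require Import ring lra.
From mathcomp Require Import all_classical all_reals all_analysis.

Set Implicit Arguments.
Unset Strict Implicit.
Unset Printing Implicit Defensive.

Import Order.TTheory GRing.Theory Num.Theory.
Import numFieldNormedType.Exports.

Local Open Scope classical_set_scope.
Local Open Scope ring_scope.

(** Write W = 1 - alpha L.  A mode of the uncontrolled error dynamics W (x) A is
    a product (1 - alpha x) eta of eigenvalues of W and A.  The step-size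
    condition makes all those with x <> 0 strictly stable, so that an
    eigenvector for |z| >= 1 must be a consensus vector: all blocks equal to one
    eigenvector of A (consensus_eigenvector, contracting_modes).

    One observer, the root, can therefore do all the work.
    - Actuation: the root corrects its own estimation error only.  This reaches
      every unstable mode, because a left consensus eigenvector that vanishes at
      the root is zero (relay_plant_stabilizable).
    - Measurement: every observer relays the outputs it knows of to its parent
      in a spanning tree directed to the root.  On an eigenvector for z the root
      then reads the outputs of observer i multiplied by a nonzero power of z,
      each in its own coordinates.  Hence it sees every unstable mode that some
      C_i sees, and by detectability of (A, C) that is all of them
      (relay_plant_detectable).
    - Control: the errors together with the relays form one detectable and
      stabilizable pair, so a centralized observer-based controller stabilizes
      it (observer_controller).  Its state, a copy of the whole network, is
      stored as augmented state of the root, and its only links to the network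
      are the relay and the error of the root itself.

    Only the relays use the edges of the graph, which gives the sparsity
    constraint.  Stability is always checked on eigenvectors: a matrix is Schur
    stable when it has no eigenvector for an eigenvalue with |z| >= 1.

    The gains of the centralized controller are deadbeat gains: for any pair
    (A, C) over any field there is an L such that C (A + L C)^k = 0 for some k
    (deadbeat_observer).  An eigenvector of A + L C for z <> 0 is then
    unobservable, hence an eigenvector of A itself, and the Hautus condition
    excludes it for |z| >= 1. *)

Local Notation toC := (map_mx (real_complex _)).

(** * Deadbeat observer gains *)

(** One step of the construction of a deadbeat gain.  Choose a complement D of U
    inside U + s, with rows taken in s.  The new gain K' equals K on U, and on a
    row y s of D its value is c y, so that y s (A + K' C) = y (s A + c C) falls
    into U. *)
Lemma deadbeat_step (F : fieldType) (n p : nat) (A U : 'M[F]_n)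
    (C s : 'M[F]_(p, n)) (K : 'M[F]_(n, p)) (c : F) (N : nat) :
  (U *m (A + K *m C)%R <= U)%MS -> U *m (A + K *m C) ^+ N = 0 ->
  ((s *m A + c *: C)%R <= U)%MS ->
  exists K' : 'M[F]_(n, p), ((U + s)%MS *m (A + K' *m C)%R <= (U + s)%MS)%MS /\
    (U + s)%MS *m (A + K' *m C) ^+ N.+1 = 0.
Proof.
move=> Uinv Unil sU; pose D := (s :\: U)%MS.
have DU0 : (D :&: U = 0)%MS by rewrite capmx_diff.
have UD0 : (U :&: D = 0)%MS by rewrite capmxC.
have sUD : ((U + s)%MS <= (U + D)%MS)%MS.
  rewrite addsmx_sub addsmxSl /= -(addsmx_diff_cap_eq s U) addsmx_sub addsmxSr.
  by rewrite (submx_trans (capmxSr _ _)) ?addsmxSl.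
have [P [PU PD]] : exists P : 'M[F]_n, U *m P = U /\ D *m P = 0.
  by exists (proj_mx U D); split; [exact: proj_mx_id | exact: proj_mx_0].
have [Q [QU QD]] : exists Q : 'M[F]_n, U *m Q = 0 /\ D *m Q = D.
  by exists (proj_mx D U); split; [exact: proj_mx_0 | exact: proj_mx_id].
have [Z DZ] : exists Z : 'M[F]_(n, p), D *m Z *m s = D.
  by exists (pinvmx s); rewrite mulmxKpV ?diffmxSl.
pose K' := P *m K + c *: (Q *m Z).
have UK : U *m (A + K' *m C) = U *m (A + K *m C).
  rewrite !mulmxDr !mulmxA /K' mulmxDr -scalemxAr !mulmxA.
  by rewrite PU QU mul0mx scaler0 addr0.
have DK : (D *m (A + K' *m C)%R <= U)%MS.
  have -> : D *m (A + K' *m C) = D *m Z *m (s *m A + c *: C).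
    rewrite !mulmxDr !mulmxA DZ /K' mulmxDr -!scalemxAr !mulmxA.
    by rewrite QD PD mul0mx add0r -scalemxAl.
  by apply: mulmx_sub; exact: sU.
have UsU : ((U + s)%MS *m (A + K' *m C)%R <= U)%MS.
  have [[Y X] /= ->] := sub_addsmxP sUD.
  rewrite mulmxDl -!(mulmxA _ _ (A + _)) UK.
  by apply: addmx_sub; apply: mulmx_sub; [exact: Uinv | exact: DK].
exists K'; split; first by rewrite (submx_trans UsU) ?addsmxSl.
(* The gains agree on U, which is invariant, so their powers agree on U. *)
have UN k : U *m (A + K' *m C) ^+ k = U *m (A + K *m C) ^+ k.
  elim: k => [|k IH]; first by rewrite !expr0.
  rewrite !exprS -!mulmxE !mulmxA UK.
  by have [Y ->] := submxP Uinv; rewrite -!mulmxA IH.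
rewrite exprS -mulmxE mulmxA; have [Y ->] := submxP UsU.
by rewrite -mulmxA UN Unil mulmx0.
Qed.

(** Horner's scheme on g.  If g = h X + c then C g(A) = (C h(A)) A + c C, which is
    the hypothesis of deadbeat_step with s = C h(A).  The subspace U thus absorbs
    the rows of C h(A) for one Horner quotient h after the other, until h is a
    nonzero constant and U contains the rows of C. *)
Lemma deadbeat_chain (F : fieldType) (n p : nat) (A : 'M[F]_n.+1)
    (C : 'M[F]_(p, n.+1)) (g : {poly F}) (U : 'M[F]_n.+1) (K : 'M[F]_(n.+1, p))
    (N : nat) :
  g != 0 -> (U *m (A + K *m C)%R <= U)%MS -> U *m (A + K *m C) ^+ N = 0 ->
  (C *m horner_mx A g <= U)%MS ->
  exists (L : 'M[F]_(n.+1, p)) (k : nat), C *m (A + L *m C) ^+ k = 0.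
Proof.
elim/poly_ind: g U K N => [|g c IH] U K N; first by rewrite eqxx.
move=> gX0 Uinv Unil; rewrite rmorphD rmorphM /= horner_mx_X horner_mx_C.
rewrite mulmxDr -mulmxE mulmxA mul_mx_scalar.
have [g0 | g0] := eqVneq g 0.
  rewrite g0 rmorph0 mulmx0 mul0mx add0r => CU.
  have c0 : c != 0 by move: gX0; rewrite g0 mul0r add0r polyC_eq0.
  exists K, N; have /submxP[Y CY] : (C <= U)%MS.
    by rewrite -[C](scalerK c0) scalemx_sub.
  by rewrite {1}CY -mulmxA Unil mulmx0.
case/(deadbeat_step Uinv Unil) => K' [Uinv' Unil'].
exact: IH g0 Uinv' Unil' (addsmxSr _ _).
Qed.

(** The chain starts from U = 0: by Cayley-Hamilton, C g(A) = 0 for the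
    characteristic polynomial g of A. *)
Lemma deadbeat_observer (F : fieldType) (n p : nat) (A : 'M[F]_n)
    (C : 'M[F]_(p, n)) :
  exists (L : 'M[F]_(n, p)) (k : nat), C *m (A + L *m C) ^+ k = 0.
Proof.
case: n A C => [|n] A C.
  by exists 0, 0%N; rewrite (flatmx0 _) [C]thinmx0 mul0mx.
apply: (@deadbeat_chain _ _ _ A C (char_poly A) 0 0 0).
- exact/monic_neq0/char_poly_monic.
- by rewrite mul0mx sub0mx.
- by rewrite mul0mx.
- by rewrite Cayley_Hamilton mulmx0 sub0mx.
Qed.

(** * Stabilization by an observer-based controller *)

Lemma eigenvalue_tr (F : fieldType) (n : nat) (M : 'M[F]_n) :
  eigenvalue M^T =1 eigenvalue M.
Proof.
move=> z; rewrite !eigenvalue_root_char; congr (root _ z).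
rewrite /char_poly -det_tr /char_poly_mx; congr (\det _).
by rewrite linearB /= tr_scalar_mx map_trmx trmxK.
Qed.

(** Eigenvalues are defined by row vectors, whereas states are columns. *)
Lemma schur_stableP (R : realType) (n : nat) (M : 'M[R]_n) :
  schur_stable M <->
  forall (z : R[i]) (x : 'cV[R[i]]_n),
    1 <= `|z| -> toC M *m x = z *: x -> x = 0.
Proof.
split=> [stM z x z1 Mx | stM z].
  apply/eqP/negP => /negP x0.
  have /stM : spectrum M z.
    rewrite /spectrum /= -eigenvalue_tr; apply/eigenvalueP; exists x^T.
      by rewrite -trmx_mul Mx linearZ.
    by rewrite trmx_eq0.
  by move=> /lt_geF; rewrite z1.
rewrite /spectrum /= -eigenvalue_tr => /eigenvalueP[v vM v0].
rewrite real_ltNge ?normr_real ?real1 //; apply/negP => z1.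
have /(stM _ _ z1)/eqP : toC M *m v^T = z *: v^T.
  by rewrite -[LHS]trmxK trmx_mul trmxK vM linearZ.
by rewrite trmx_eq0 (negPf v0).
Qed.

(** The Hautus test for discrete-time detectability.  Stabilizability of (A, B)
    is expressed as the test for the transposed pair. *)
Definition hautus (R : realType) (n p : nat) (A : 'M[R]_n) (C : 'M[R]_(p, n)) :=
  forall (z : R[i]) (x : 'cV[R[i]]_n),
    1 <= `|z| -> toC A *m x = z *: x -> toC C *m x = 0 -> x = 0.

Lemma map_mx_exp (aR rR : pzRingType) (f : {rmorphism aR -> rR}) n
  (M : 'M[aR]_n) k : map_mx f (M ^+ k) = map_mx f M ^+ k.
Proof.
elim: k => [|k IH]; first by rewrite !expr0; exact: map_mx1.
by rewrite !exprS -!mulmxE map_mxM IH.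
Qed.

Lemma mulmx_exp_eigen (F : fieldType) n (M : 'M[F]_n) (z : F) (x : 'cV[F]_n) k :
  M *m x = z *: x -> M ^+ k *m x = z ^+ k *: x.
Proof.
move=> Mx; elim: k => [|k IH]; first by rewrite !expr0 scale1r; exact: mul1mx.
by rewrite exprSr -mulmxE -mulmxA Mx -scalemxAr IH scalerA exprS.
Qed.

(** With a deadbeat gain, z ^+ k *: (C *m x) = 0 for every eigenvector x of
    A - L *m C; so z <> 0 forces C *m x = 0, and x is an eigenvector of A. *)
Lemma hautus_observer (R : realType) (n p : nat) (A : 'M[R]_n)
    (C : 'M[R]_(p, n)) :
  hautus A C -> exists L : 'M[R]_(n, p), schur_stable (A - L *m C).
Proof.
move=> hAC; have [L [k LC]] := deadbeat_observer A C.
exists (- L); apply/schur_stableP => z x z1; rewrite mulNmx opprK => Mx.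
have z0 : z != 0 by rewrite -normr_gt0 (lt_le_trans ltr01 z1).
have Cx : toC C *m x = 0.
  have := congr1 (fun M => toC M *m x) LC.
  rewrite map_mxM -mulmxA map_mx_exp (mulmx_exp_eigen _ Mx) -scalemxAr.
  rewrite map_mx0 mul0mx => /eqP.
  by rewrite scaler_eq0 expf_eq0 (negPf z0) andbF => /eqP.
apply: (hAC z x z1 _ Cx).
by move: Mx; rewrite map_mxD map_mxM mulmxDl -mulmxA Cx mulmx0 addr0.
Qed.

Lemma schur_stable_tr (R : realType) (n : nat) (M : 'M[R]_n) :
  schur_stable M^T -> schur_stable M.
Proof.
by move=> stM z; rewrite /spectrum /= -eigenvalue_tr map_trmx; exact: stM.
Qed.

Lemma hautus_feedback (R : realType) (n p : nat) (A : 'M[R]_n)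
    (B : 'M[R]_(n, p)) :
  hautus A^T B^T -> exists K : 'M[R]_(p, n), schur_stable (A + B *m K).
Proof.
move=> /hautus_observer[L stL]; exists (- L^T); apply: schur_stable_tr.
by rewrite linearD /= trmx_mul linearN /= trmxK mulNmx.
Qed.

(** The separation principle.  The controller state y is an estimate of x that
    copies the closed-loop plant, G = A + B K - L C.  The estimation error x - y
    evolves by A - L C, and once it vanishes x evolves by A + B K. *)
Lemma observer_controller (R : realType) (n p q : nat) (A : 'M[R]_n)
    (B : 'M[R]_(n, p)) (C : 'M[R]_(q, n)) :
  hautus A C -> hautus A^T B^T ->
  exists (K : 'M[R]_(p, n)) (L : 'M[R]_(n, q)) (G : 'M[R]_n),
  forall (z : R[i]) (x y : 'cV[R[i]]_n), 1 <= `|z| ->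
    toC A *m x + toC B *m (toC K *m y) = z *: x ->
    toC L *m (toC C *m x) + toC G *m y = z *: y -> x = 0 /\ y = 0.
Proof.
move=> /hautus_observer[L /schur_stableP stL].
move=> /hautus_feedback[K /schur_stableP stK].
exists K, L, (A + B *m K - L *m C) => z x y z1 Ax Gy.
have xy : x - y = 0.
  apply: (stL z) => //; rewrite scalerBr -Ax -Gy.
  rewrite !(map_mxD, map_mxN, map_mxM) !(mulmxDl, mulmxBr, mulNmx) !mulmxA.
  have aux (V : zmodType) (a a' b c c' : V) :
      a - a' + (- c - - c') = a + b - (c + (a' + b - c')).
    rewrite !(opprD, opprK) !addrA [RHS](ACl (1*4*3*6*(2*5)))/=.
    by rewrite subrr addr0.
  exact: aux.
have exy : x = y by apply/eqP; rewrite -subr_eq0 xy.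
suff x0 : x = 0 by rewrite -exy x0.
apply: (stK z) => //; rewrite -Ax -exy.
by rewrite map_mxD map_mxM mulmxDl mulmxA.
Qed.

(** * Detectability and complex eigenvectors *)

Lemma normc_real (R : realType) (a : R) : `|a%:C%C| = `|a|%:C%C.
Proof. by rewrite normc_def /= expr0n addr0 sqrtr_sqr. Qed.

Lemma Re_mul_toC (R : realType) (m n p : nat) (M : 'M[R]_(m, n))
    (x : 'M[R[i]]_(n, p)) :
  map_mx (@complex.Re R) (toC M *m x) = M *m map_mx (@complex.Re R) x.
Proof.
apply/matrixP => i j; rewrite !mxE raddf_sum /=; apply: eq_bigr => k _.
by rewrite !mxE; case: (x k j) => a b /=; rewrite mul0r subr0.
Qed.

Lemma Im_mul_toC (R : realType) (m n p : nat) (M : 'M[R]_(m, n))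
    (x : 'M[R[i]]_(n, p)) :
  map_mx (@complex.Im R) (toC M *m x) = M *m map_mx (@complex.Im R) x.
Proof.
apply/matrixP => i j; rewrite !mxE raddf_sum /=; apply: eq_bigr => k _.
by rewrite !mxE; case: (x k j) => a b /=; rewrite mul0r addr0.
Qed.

Lemma cvg0_coord (R : realType) (n : nat) (u : nat -> 'cV[R]_n) (j : 'I_n)
    (eps : R) :
  u @ \oo --> (0 : 'cV[R]_n) -> 0 < eps ->
  \forall k \near \oo, `|u k j 0| < eps.
Proof.
move=> u0 eps0.
have /cvgr0Pnorm_lt : (fun k => u k j 0) @ \oo --> (0 : R).
  have := cvg_comp _ _ u0 (@coord_continuous _ _ _ j 0 0).
  by rewrite mxE; exact.
by apply.
Qed.

(** Let x be an unobservable complex eigenvector for z.  The real and imaginary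
    parts of z ^+ k *: x are trajectories of A with zero output, so they tend to
    0; but the modulus of each entry of z ^+ k *: x is at least that of x. *)
Lemma detectable_hautus (R : realType) (n p : nat) (A : 'M[R]_n)
    (C : 'M[R]_(p, n)) :
  detectable A C -> hautus A C.
Proof.
move=> det z x z1 Ax Cx.
have decay (h : {additive R[i] -> R}) :
    (forall (m n p : nat) (M : 'M[R]_(m, n)) (y : 'M[R[i]]_(n, p)),
      map_mx h (toC M *m y) = M *m map_mx h y) ->
    (fun k => map_mx h (z ^+ k *: x)) @ \oo --> (0 : 'cV[R]_n).
  move=> hM.
  have Ahx k : map_mx h (z ^+ k *: x) = A ^+ k *m map_mx h x.
    by rewrite -hM map_mx_exp (mulmx_exp_eigen _ Ax).
  under eq_fun do rewrite Ahx.
  apply: det => k.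
  by rewrite -Ahx -hM -scalemxAr Cx scaler0 map_mx0.
apply/matrixP => j i; rewrite ord1 mxE; apply/eqP/negP => /negP xj0.
(* If the real and imaginary parts of z ^+ k * x j 0 are both below s / 2, then
   its modulus is below s, the modulus of x j 0. *)
pose s := complex.Re `|x j 0|.
have sE : s%:C%C = `|x j 0| by rewrite RRe_real ?normr_real.
have s2 : 0 < s / 2 by rewrite divr_gt0 // -ltcR sE normr_gt0.
have [k [/= + +]] := filter_ex (filterI
  (cvg0_coord j (decay (@complex.Re R) (@Re_mul_toC R)) s2)
  (cvg0_coord j (decay (@complex.Im R) (@Im_mul_toC R)) s2)).
rewrite !mxE; set y := z ^+ k * x j 0 => Rey Imy.
have : `|x j 0| <= `|y|.
  by rewrite normrM ler_peMl // normrX exprn_ege1.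
apply/negP; rewrite -real_ltNge ?normr_real // -sE [y]complexE.
rewrite (le_lt_trans (ler_normD _ _)) // normrM normCi mul1r.
rewrite !normc_real -rmorphD ltcR.
by rewrite [ltRHS](splitr s) ltrD.
Qed.

(** * The Laplacian of a connected graph *)

Lemma laplacian_mulE (R : realType) (m n : nat) (e : rel 'I_m)
    (v : 'M[R]_(m, n)) i k :
  (laplacian R e *m v) i k = \sum_j (e i j)%:R * (v i k - v j k).
Proof.
rewrite mxE (bigD1 i) //= [RHS](bigD1 i) //= subrr mulr0 add0r.
rewrite mxE eqxx mulr_suml -big_split; apply: eq_bigr => j ji /=.
by rewrite mxE eq_sym (negPf ji) mulrBr mulNr.
Qed.

Lemma laplacian_tr (R : realType) (m : nat) (e : rel 'I_m) :
  symmetric e -> (laplacian R e)^T = laplacian R e.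
Proof.
move=> e_sym; apply/matrixP => i j; rewrite !mxE eq_sym.
by case: eqVneq => [->|_] //; rewrite e_sym.
Qed.

(** The quadratic form of the Laplacian is half the sum of (v i - v j)^2 over the
    ordered edges; if it is nonpositive at v, then v is constant along edges. *)
Lemma laplacian_nonpos_eigenvector (R : realType) (m : nat) (e : rel 'I_m)
    (e_sym : symmetric e) (e_conn : forall i j : 'I_m, connect e i j)
    (v : 'cV[R]_m) (x : R) :
  x <= 0 -> laplacian R e *m v = x *: v -> forall i j, v i 0 = v j 0.
Proof.
move=> x0 Lv.
have quad : \sum_i \sum_j (e i j)%:R * (v i 0 - v j 0) ^+ 2
    = 2 * \sum_i v i 0 * (laplacian R e *m v) i 0.
  rewrite mulr_natl mulr2n.
  have E1 : \sum_i v i 0 * (laplacian R e *m v) i 0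
      = \sum_i \sum_j (e i j)%:R * (v i 0 * (v i 0 - v j 0)).
    apply: eq_bigr => i _; rewrite laplacian_mulE mulr_sumr.
    by apply: eq_bigr => j _; rewrite mulrCA.
  have E2 : \sum_i v i 0 * (laplacian R e *m v) i 0
      = \sum_i \sum_j (e i j)%:R * (v j 0 * (v j 0 - v i 0)).
    rewrite E1 exchange_big; apply: eq_bigr => i _; apply: eq_bigr => j _.
    by rewrite e_sym.
  rewrite {1}E1 E2 -big_split; apply: eq_bigr => i _ /=.
  rewrite -big_split; apply: eq_bigr => j _ /=.
  by rewrite -mulrDr; congr (_ * _); ring.
have quad0 : \sum_i \sum_j (e i j)%:R * (v i 0 - v j 0) ^+ 2 = 0.
  apply/eqP; rewrite eq_le; apply/andP; split; last first.
    by do 2!apply: sumr_ge0 => ? _; rewrite mulr_ge0 ?sqr_ge0.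
  rewrite quad Lv pmulr_rle0 //; apply: sumr_le0 => i _.
  by rewrite mxE mulrCA mulr_le0_ge0 // -expr2 sqr_ge0.
have edge i j : e i j -> v i 0 = v j 0.
  move=> eij; move/eqP: quad0.
  rewrite psumr_eq0 => [|k _]; last first.
    by apply: sumr_ge0 => ? _; rewrite mulr_ge0 ?sqr_ge0.
  move=> /allP/(_ i); rewrite mem_index_enum => /(_ isT)/=.
  rewrite psumr_eq0 => [|k _]; last by rewrite mulr_ge0 ?sqr_ge0.
  move=> /allP/(_ j); rewrite mem_index_enum => /(_ isT)/=.
  by rewrite eij mul1r sqrf_eq0 subr_eq0 => /eqP.
move=> i j; have /connectP[s + ->] := e_conn i j.
elim: s i => //= k s IH i /andP[/edge -> ks].
exact: IH.
Qed.

Lemma laplacian_kernel (R : realType) (m n : nat) (e : rel 'I_m)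
    (e_sym : symmetric e) (e_conn : forall i j : 'I_m, connect e i j)
    (E : 'M[R[i]]_(m, n)) :
  toC (laplacian R e) *m E = 0 -> forall i j, row i E = row j E.
Proof.
move=> LE i j; apply/rowP => k; rewrite !mxE.
have real_kernel (F : 'M[R]_(m, n)) :
    laplacian R e *m F = 0 -> F i k = F j k.
  move=> LF; have := laplacian_nonpos_eigenvector e_sym e_conn
    (v := col k F) (lexx 0) _ i j.
  by rewrite !mxE; apply; rewrite colE mulmxA LF mul0mx scale0r.
have := real_kernel (map_mx (@complex.Re R) E).
rewrite -Re_mul_toC LE map_mx0 !mxE => /(_ erefl).
have := real_kernel (map_mx (@complex.Im R) E).
rewrite -Im_mul_toC LE map_mx0 !mxE => /(_ erefl).
by case: (E i k) (E j k) => a b [c d] /= -> ->.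
Qed.

(** An eigenvector for a negative eigenvalue would be constant by the previous
    argument, and the Laplacian annihilates constants. *)
Lemma laplacian_eigenvalue_gt0 (R : realType) (m : nat) (e : rel 'I_m)
    (e_sym : symmetric e) (e_conn : forall i j : 'I_m, connect e i j) (x : R) :
  eigenvalue (laplacian R e) x -> x != 0 -> 0 < x.
Proof.
rewrite -eigenvalue_tr => /eigenvalueP[v vL v0] x0.
rewrite lt_neqAle eq_sym x0 leNgt; apply/negP => x_lt0.
have Lv : laplacian R e *m v^T = x *: v^T.
  by rewrite -[LHS]trmxK trmx_mul trmxK vL linearZ.
have vE := laplacian_nonpos_eigenvector e_sym e_conn (ltW x_lt0) Lv.
have Lv0 : laplacian R e *m v^T = 0.
  apply/colP => i; rewrite laplacian_mulE [RHS]mxE big1 // => j _.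
  by rewrite (vE i j) subrr mulr0.
move/eqP: Lv; rewrite Lv0 eq_sym scaler_eq0 (negPf x0) /=.
by rewrite trmx_eq0 (negPf v0).
Qed.

Lemma laplacian_eigenvalue0 (R : realType) (m : nat) (e : rel 'I_m) :
  symmetric e -> (0 < m)%N -> eigenvalue (laplacian R e) 0.
Proof.
move=> e_sym m_gt0; rewrite -eigenvalue_tr; apply/eigenvalueP.
exists (const_mx 1); last first.
  apply/eqP => /rowP/(_ (Ordinal m_gt0))/eqP.
  by rewrite !mxE oner_eq0.
rewrite -[LHS]trmxK trmx_mul trmxK scale0r -[RHS]trmx0; congr trmx.
apply/matrixP => i k; rewrite laplacian_mulE [RHS]mxE big1 // => j _.
by rewrite !mxE subrr mulr0.
Qed.

Lemma char_poly_spectral (C : numClosedFieldType) (n : nat) (M : 'M[C]_n) :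
  M \is normalmx ->
  char_poly M = \prod_(i < n) ('X - (spectral_diag M 0 i)%:P).
Proof.
move=> /orthomx_spectralP ME; rewrite {1}ME.
set U := spectralmx M; have Uu : U \in unitmx := spectral_unit M.
have -> : char_poly (invmx U *m diag_mx (spectral_diag M) *m U)
    = char_poly (diag_mx (spectral_diag M)).
  rewrite /char_poly /char_poly_mx.
  have -> : 'X%:M - map_mx polyC (invmx U *m diag_mx (spectral_diag M) *m U)
     = map_mx polyC (invmx U) *m
       ('X%:M - map_mx polyC (diag_mx (spectral_diag M))) *m map_mx polyC U.
    rewrite !map_mxM mulmxBr mulmxBl; congr (_ - _).
    rewrite -mulmxA -scalar_mxC mulmxA -map_mxM mulVmx // map_mx1.
    by rewrite mul1mx.
  rewrite !det_mulmx mulrC mulrA -det_mulmx -map_mxM mulmxV // map_mx1 det1.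
  by rewrite mul1r.
rewrite char_poly_trig ?diag_mx_is_trig //.
by apply: eq_bigr => i _; rewrite mxE eqxx.
Qed.

Lemma laplacian_normal (R : realType) (m : nat) (e : rel 'I_m) :
  symmetric e -> toC (laplacian R e) \is normalmx.
Proof.
move=> e_sym; apply/normalmxP.
suff -> : ((toC (laplacian R e))^t*)%sesqui = toC (laplacian R e) by [].
rewrite map_trmx laplacian_tr //; apply/matrixP => i j.
by rewrite !mxE conj_Creal // complex_real.
Qed.

(** * Unstable modes of the coupled system lie in consensus *)

Lemma laplacian_spectral_perm (R : realType) (m : nat) (e : rel 'I_m)
    (e_sym : symmetric e) (lam : m.-tuple R) :
  ordered_eigenvalues (laplacian R e) lam ->
  perm_eq [seq spectral_diag (toC (laplacian R e)) 0 i | i <- index_enum 'I_m]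
          [seq x%:C%C | x <- lam].
Proof.
move=> [_ cp]; apply: prod_XsubC_eq; rewrite !big_map /=.
rewrite -char_poly_spectral ?laplacian_normal // -map_char_poly cp rmorph_prod.
by apply: eq_bigr => x _; rewrite rmorphB /= map_polyX map_polyC.
Qed.

Lemma spectral_row (C : numClosedFieldType) (m : nat) (M : 'M[C]_m) :
  M \is normalmx ->
  spectralmx M *m M = diag_mx (spectral_diag M) *m spectralmx M.
Proof.
move=> /orthomx_spectralP {2}->.
by rewrite !mulmxA mulmxV ?spectral_unit ?mul1mx.
Qed.

(** The eigenvalue 0 is algebraically simple: rows of the spectral basis for the
    eigenvalue 0 are constant vectors, and an invertible matrix does not have two
    proportional rows. *)
Lemma laplacian_zero_simple (R : realType) (m : nat) (e : rel 'I_m)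
    (e_sym : symmetric e) (e_conn : forall i j : 'I_m, connect e i j) 
    (M := toC (laplacian R e)) (i j : 'I_m) :
  spectral_diag M 0 i = 0 -> spectral_diag M 0 j = 0 -> i = j.
Proof.
move=> di dj; apply/eqP/negP => /negP ij.
pose U := spectralmx M.
have Uu : row_free U by rewrite row_free_unit spectral_unit.
have MN : M \is normalmx by exact: laplacian_normal.
have Uconst k : spectral_diag M 0 k = 0 -> forall a b, U k a = U k b.
  move=> dk a b.
  suff /laplacian_kernel : toC (laplacian R e) *m (row k U)^T = 0.
    by move=> /(_ e_sym e_conn a b)/rowP/(_ 0); rewrite !mxE.
  rewrite -[LHS]trmxK trmx_mul trmxK map_trmx laplacian_tr // -/M -row_mul.
  by rewrite spectral_row // row_mul row_diag_mx dk scale0r mul0mx trmx0.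
have Uinj (w : 'rV_m) : w *m U = 0 -> w = 0.
  by move=> wU; apply: (row_free_inj Uu); rewrite /= wU mul0mx.
have Uz k : spectral_diag M 0 k = 0 -> U k i != 0.
  move=> dk; apply/eqP => Uk0.
  have /Uinj : (delta_mx 0 k : 'rV_m) *m U = 0.
    by rewrite -rowE; apply/rowP => b; rewrite !mxE (Uconst k dk b i).
  by move=> /rowP/(_ k)/eqP; rewrite !mxE !eqxx oner_eq0.
have /Uinj :
    (U j i *: delta_mx 0 i - U i i *: delta_mx 0 j : 'rV_m) *m U = 0.
  rewrite mulmxBl -!scalemxAl -!rowE; apply/rowP => b.
  by rewrite !mxE (Uconst i di b i) (Uconst j dj b i) mulrC subrr.
move=> /rowP/(_ i)/eqP.
by rewrite !mxE !eqxx (negPf ij) mulr0 subr0 mulr1 (negPf (Uz j dj)).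
Qed.

Section OrderedSpectrum.
Variables (R : realType) (m : nat) (m_gt1 : (1 < m)%N) (e : rel 'I_m).
Hypotheses (e_sym : symmetric e) (e_conn : forall i j : 'I_m, connect e i j).
Variable (lam : m.-tuple R).
Hypothesis (hlam : ordered_eigenvalues (laplacian R e) lam).

Lemma mem_lam x : (x \in lam) = eigenvalue (laplacian R e) x.
Proof. by rewrite eigenvalue_root_char hlam.2 root_prod_XsubC. Qed.

Lemma lam_ge0 x : x \in lam -> 0 <= x.
Proof.
rewrite mem_lam => ex; have [->//|x0] := eqVneq x 0.
exact/ltW/(laplacian_eigenvalue_gt0 e_sym e_conn ex).
Qed.

Lemma lam_nth_le i j : (i <= j < m)%N -> lam`_i <= lam`_j.
Proof.
move=> /andP[ij jm]; apply: (sorted_leq_nth le_trans le_refl 0 hlam.1) => //.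
  by rewrite inE size_tuple (leq_ltn_trans ij).
by rewrite inE size_tuple.
Qed.

Lemma lam1_gt0 : 0 < lam`_1.
Proof.
have l1 : 0 <= lam`_1 by rewrite lam_ge0 // mem_nth // size_tuple.
have l0 : 0 <= lam`_0.
  by rewrite lam_ge0 // mem_nth // size_tuple (ltn_trans _ m_gt1).
rewrite lt_neqAle l1 andbT eq_sym; apply/eqP => l1E.
have l0E : lam`_0 = 0.
  by apply/eqP; rewrite eq_le l0 andbT (le_trans (lam_nth_le (j := 1) _)) ?l1E.
have := permP (laplacian_spectral_perm e_sym hlam) (pred1 (0 : R[i])).
have : (1 < count (pred1 (0%R : R[i])) [seq x%:C%C | x <- lam])%N.
  move: l0E l1E (size_tuple lam) m_gt1; case: (tval lam) => [|x0 [|x1 s]] /=.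
  - by move=> _ _ <-.
  - by move=> _ _ <-.
  by move=> -> -> _ _; rewrite !eqxx.
move=> /[swap] <-; rewrite count_map -sum1_count sum1dep_card.
case/card_gt1P => i [j []]; rewrite !inE => /eqP di /eqP dj.
by rewrite (laplacian_zero_simple e_sym e_conn di dj) eqxx.
Qed.

(** As 0 occurs in lam but is not among its entries of index 1 or more, it is the
    first entry, and every nonzero eigenvalue comes later. *)
Lemma lam_range x : x \in lam -> x != 0 -> lam`_1 <= x <= lam`_m.-1.
Proof.
move=> xlam x0; have := xlam; rewrite mem_lam => /[dup] ex.
move=> /(laplacian_eigenvalue_gt0 e_sym e_conn)/(_ x0) x_gt0.
have m_gt0 : (0 < m)%N by exact: ltn_trans m_gt1.
have l0 : lam`_0 = 0.
  have := laplacian_eigenvalue0 R e_sym m_gt0; rewrite -mem_lam.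
  move=> /(nthP 0)[[|k]]; rewrite size_tuple => km // lk.
  by have := lam_nth_le (i := 1) (j := k.+1) km; rewrite lk leNgt lam1_gt0.
move: xlam => /(nthP 0)[[|k]]; rewrite size_tuple => km xE.
  by move: x0; rewrite -xE l0 eqxx.
rewrite -xE; apply/andP; split; apply: lam_nth_le; first exact: km.
by rewrite ltn_predL m_gt0 andbT -ltnS prednK.
Qed.

Lemma spectral_diag_lam i :
  exists2 x, x \in lam & spectral_diag (toC (laplacian R e)) 0 i = x%:C%C.
Proof.
have : spectral_diag (toC (laplacian R e)) 0 i \in [seq x%:C%C | x <- lam].
  rewrite -(perm_mem (laplacian_spectral_perm e_sym hlam)).
  exact/map_f/mem_index_enum.
by move=> /mapP[x xlam ->]; exists x.
Qed.

(** In the spectral basis U of L the eigenvector equation decouples.  With E the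
    matrix of rows v i, row f of U E attached to an eigenvalue x of L satisfies
    (1 - alpha x) f A^T = z f.  If f <> 0 and x <> 0, then z / (1 - alpha x) is an
    eigenvalue of A, so |z| < 1 by the contraction hypothesis.  Hence L E = 0, and the kernel of L
    consists of constants. *)
Lemma consensus_eigenvector (n : nat) (A : 'M[R]_n) (alpha : R)
    (contracting : forall x eta, x \in lam -> x != 0 ->
       eigenvalue (toC A) eta -> `|(1 - alpha * x)%:C%C * eta| < 1)
    (z : R[i]) (v : 'I_m -> 'cV[R[i]]_n) :
  1 <= `|z| ->
  (forall i, \sum_j ((1%:M - alpha *: laplacian R e) i j)%:C%C *: (toC A *m v j)
     = z *: v i) ->
  forall i j, v i = v j.
Proof.
move=> z1 Wv; pose L := toC (laplacian R e); pose U := spectralmx L.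
have z0 : z != 0 by rewrite -normr_gt0 (lt_le_trans ltr01 z1).
pose E := \matrix_(i < m) (v i)^T.
have WE : (1%:M - alpha%:C%C *: L) *m E *m (toC A)^T = z *: E.
  have -> : 1%:M - alpha%:C%C *: L = toC (1%:M - alpha *: laplacian R e).
    by rewrite map_mxB map_mx1 map_mxZ.
  apply/row_matrixP => i; rewrite 2!row_mul [RHS]linearZ /= /E rowK.
  rewrite -linearZ /= -Wv.
  rewrite (mulmx_sum_row (row i _)) mulmx_suml linear_sum.
  apply: eq_bigr => j _.
  by rewrite rowK /= [RHS]linearZ /= trmx_mul -scalemxAl !mxE.
have UL : U *m L = diag_mx (spectral_diag L) *m U.
  exact/spectral_row/laplacian_normal.
have F0 i : spectral_diag L 0 i != 0 -> row i (U *m E) = 0.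
  move=> di; have [x xlam dE] := spectral_diag_lam i.
  have x0 : x != 0 by apply: contraNneq di => x0; rewrite dE x0.
  apply/eqP/negP => /negP f0; set f := row i (U *m E) in f0 *.
  have fA : (1 - alpha * x)%:C%C *: (f *m (toC A)^T) = z *: f.
    have UW : row i (U *m (1%:M - alpha%:C%C *: L))
        = (1 - alpha * x)%:C%C *: row i U.
      rewrite mulmxBr mulmx1 -scalemxAr UL linearB [X in _ - X]linearZ /=.
      rewrite row_mul row_diag_mx -scalemxAl -rowE dE scalerA.
      by rewrite rmorphB rmorph1 rmorphM scalerBl scale1r.
    rewrite /f [row i (U *m E)]row_mul -mulmxA scalemxAl -UW.
    rewrite -(row_mul i (U *m _)) -(mulmxA U).
    by rewrite (mulmxA _ E) WE -scalemxAr linearZ /= row_mul.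
  set c := (1 - alpha * x)%:C%C in fA.
  have c0 : c != 0.
    apply/eqP => c0; move: fA; rewrite c0 scale0r => /esym/eqP.
    by rewrite scaler_eq0 (negPf z0) (negPf f0).
  have : eigenvalue (toC A) (z / c).
    rewrite -eigenvalue_tr; apply/eigenvalueP; exists f => //.
    by rewrite mulrC -scalerA -fA scalerA mulVf // scale1r.
  move=> /(contracting x _ xlam x0); rewrite -/c mulrC divfK //.
  by move=> /lt_geF; rewrite z1.
have LE : L *m E = 0.
  have Uu : U \in unitmx by exact: spectral_unit.
  rewrite -[L *m E](mulKmx Uu) (mulmxA U) UL -(mulmxA (diag_mx _)).
  rewrite [X in invmx U *m X](_ : _ = 0) ?mulmx0 //; apply/row_matrixP => i.


  rewrite row_mul row_diag_mx -scalemxAl -rowE row0.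
  have [->|/F0->] := eqVneq (spectral_diag L 0 i) 0; first by rewrite scale0r.
  by rewrite scaler0.
move=> i j; apply/colP => k.
by have /rowP/(_ k) := laplacian_kernel e_sym e_conn LE i j; rewrite !rowK !mxE.
Qed.

End OrderedSpectrum.

(** * The step-size condition *)

Lemma Re_normE (R : realType) (z : R[i]) : (complex.Re `|z|)%:C%C = `|z|.
Proof. by rewrite RRe_real ?normr_real. Qed.

Lemma spectral_radius_ge (R : realType) (n : nat) (A : 'M[R]_n) (eta : R[i]) :
  eigenvalue (toC A) eta -> complex.Re `|eta| <= spectral_radius A.
Proof.
move=> Aeta; apply: ub_le_sup; last by exists eta.
have [s cpE] := closed_field_poly_normal (char_poly (toC A)).
exists (\sum_(y <- s) complex.Re `|y|) => _ [y /= Ay <-].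
have Re_ge0 (w : R[i]) : 0 <= complex.Re `|w|.
  by rewrite -lecR Re_normE normr_ge0.
have ys : y \in s.
  move: Ay; rewrite /spectrum /= eigenvalue_root_char cpE.
  by rewrite (monicP (char_poly_monic _)) scale1r root_prod_XsubC.
by rewrite (big_rem y) //= lerDl; apply: sumr_ge0 => w _; exact: Re_ge0.
Qed.

(** The two bounds on alpha say that 1 - 1/rho < alpha l1 and
    alpha lm < 1 + 1/rho, so alpha x lies within 1/rho of 1. *)
Lemma rate_bound (R : realType) (l1 lm rho alpha x : R) :
  0 < l1 -> l1 <= x <= lm -> 0 < alpha -> 0 < rho ->
  l1^-1 * (1 - rho^-1) < alpha < lm^-1 * (1 + rho^-1) ->
  `|1 - alpha * x| * rho < 1.
Proof.
move=> l1_gt0 /andP[l1x xlm] alpha_gt0 rho_gt0 /andP[].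
have lm_gt0 : 0 < lm by rewrite (lt_le_trans l1_gt0) // (le_trans l1x).
rewrite ltr_pdivrMl // ltr_pdivlMl // => lo hi.
rewrite -ltr_pdivlMr // mul1r ltr_norml.
have := ler_wpM2l (ltW alpha_gt0) l1x; have := ler_wpM2l (ltW alpha_gt0) xlm.
by move: lo hi; rewrite ![_ * alpha]mulrC => *; apply/andP; split; lra.
Qed.

Lemma contracting_modes (R : realType) (m : nat) (m_gt1 : (1 < m)%N)
    (e : rel 'I_m) (e_sym : symmetric e)
    (e_conn : forall i j : 'I_m, connect e i j)
    (lam : m.-tuple R) (hlam : ordered_eigenvalues (laplacian R e) lam)
    (n : nat) (A : 'M[R]_n) (alpha : R) (halpha : 0 < alpha)
    (halpha_bounds : spectral_radius A != 0 ->
      (lam`_1)^-1 * (1 - (spectral_radius A)^-1) < alpha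
        < (lam`_m.-1)^-1 * (1 + (spectral_radius A)^-1)) x eta :
  x \in lam -> x != 0 -> eigenvalue (toC A) eta ->
  `|(1 - alpha * x)%:C%C * eta| < 1.
Proof.
move=> xlam x0 /spectral_radius_ge; set h := complex.Re _ => h_le.
have h_ge0 : 0 <= h by rewrite -lecR Re_normE normr_ge0.
have -> : `|(1 - alpha * x)%:C%C * eta| = (`|1 - alpha * x| * h)%:C%C.
  by rewrite normrM rmorphM /= normc_real Re_normE.
rewrite (ltcR _ 1).
have [rho0 | rho0] := eqVneq (spectral_radius A) 0.
  have -> : h = 0 by apply/eqP; rewrite eq_le h_ge0 -rho0 h_le.
  by rewrite mulr0 ltr01.
have rho_gt0 : 0 < spectral_radius A.
  by rewrite lt_neqAle eq_sym rho0 (le_trans h_ge0).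
have l1_gt0 := lam1_gt0 m_gt1 e_sym e_conn hlam.
have x_range := lam_range m_gt1 e_sym e_conn hlam xlam x0.
apply: le_lt_trans
  (rate_bound l1_gt0 x_range halpha rho_gt0 (halpha_bounds rho0)).
by rewrite ler_wpM2l.
Qed.

(** * Relaying along a routing tree *)

(** Take for d the length of a shortest path from a, and for p i the last vertex
    before i on such a path. *)
Lemma routing_tree (m : nat) (e : rel 'I_m) (e_sym : symmetric e)
    (e_conn : forall i j : 'I_m, connect e i j) (a : 'I_m) :
  exists (d : 'I_m -> nat) (p : 'I_m -> 'I_m),
    forall i, i != a -> e i (p i) /\ d i = (d (p i)).+1.
Proof.
pose reach i k := [exists s : k.-tuple 'I_m, path e a s && (last a s == i)].
have reach_ex i : exists k, reach i k.
  have /connectP[s es ->] := e_conn a i.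
  by exists (size s); apply/existsP; exists (in_tuple s); rewrite /= es eqxx.
pose d i := ex_minn (reach_ex i).
suff parent i : exists j, i != a -> e i j /\ d i = (d j).+1.
  by have [p pP] := choice parent; exists d, p.
have [->|ia] := eqVneq i a; first by exists a.
have dP j : reach j (d j) by rewrite /d; case: ex_minnP.
have d_le j k : reach j k -> (d j <= k)%N.
  by rewrite /d; case: ex_minnP => ? _ + rk => /(_ _ rk).
have /existsP[[s /= /eqP sd] /andP[es /eqP sl]] := dP i.
case/lastP: s sd es sl => [|s j] /=.
  by move=> _ _ ai; rewrite ai eqxx in ia.
rewrite size_rcons rcons_path last_rcons => sd /andP[es ej] ji.
exists (last a s) => _; rewrite e_sym -ji; split=> //.
apply/eqP; rewrite ji eqn_leq; apply/andP; split.
  apply: d_le; have /existsP[t /andP[et /eqP tl]] := dP (last a s).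
  apply/existsP; exists [tuple of rcons t j] => /=.
  by rewrite rcons_path et last_rcons tl ej ji eqxx.
rewrite -sd ltnS; apply: d_le; apply/existsP.
by exists (in_tuple s); rewrite /= es eqxx.
Qed.

Section Relay.
(* a is the root, d the depth and p the parent map of the routing tree. *)
Variables (F : fieldType) (m n : nat) (a : 'I_m).
Variables (d : 'I_m -> nat) (p : 'I_m -> 'I_m).
Hypothesis dp : forall i, i != a -> d i = (d (p i)).+1.
Variables (z : F) (z0 : z != 0).
Implicit Types v y : 'I_m -> 'cV[F]_n.

(** The root a sends nothing; any other j sends its relay state to its parent. *)
Definition relay i j := (j != a) && (p j == i).

(** Each step towards the root costs a delay, that is a factor 1/z.  Weighting
    the equation of vertex i by z ^- d i makes the contribution of a child cancel
    against the term of the child itself, which leaves the root alone. *)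
Lemma relay_telescope v y :
  (forall i, y i + \sum_j (relay i j)%:R *: v j = z *: v i) ->
  \sum_i z ^- d i *: y i = (z ^- d a * z) *: v a.
Proof.
move=> yv.
have -> : \sum_i z ^- d i *: y i = 
    \sum_i z ^- d i *: (z *: v i) -
    \sum_i z ^- d i *: (\sum_j (relay i j)%:R *: v j).
  rewrite -sumrB; apply: eq_bigr => i _.
  by rewrite -scalerBr -yv addrK.
have -> : \sum_i z ^- d i *: (\sum_j (relay i j)%:R *: v j) =
    \sum_(j | j != a) z ^- d j *: (z *: v j).
  under eq_bigr do rewrite scaler_sumr.
  rewrite exchange_big [RHS]big_mkcond /=; apply: eq_bigr => j _.
  rewrite (bigD1 (p j)) //= big1 => [|i ij]; last first.
    by rewrite /relay [_ == i]eq_sym (negPf ij) andbF scale0r scaler0.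
  rewrite /relay eqxx andbT addr0; case: eqVneq => [_|ja] /=.
    by rewrite scale0r scaler0.
  by rewrite scale1r scalerA (dp ja) exprS invfM -mulrA mulrC mulfK ?scale1r.
by rewrite (bigD1 a) //= addrK scalerA.
Qed.

(** Data move towards the root, so no state persists without input: vanishing
    propagates from the deepest vertices to the root. *)
Lemma relay_nilpotent v :
  (forall i, \sum_j (relay i j)%:R *: v j = z *: v i) -> forall i, v i = 0.
Proof.
move=> vE i; pose D := (\max_j d j)%N.
(* Induction on the number of levels below the deepest one: i is handled after
   its children, and no vertex lies at a depth above D. *)
have : (D < d i + D.+1)%N by rewrite addnS ltnS leq_addl.
elim: {2}D.+1 i => [|k IH] i.
  by rewrite addn0 ltnNge leq_bigmax.
move=> Dk; apply/eqP; have := vE i; rewrite big1 => [/esym/eqP|j _].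
  by rewrite scaler_eq0 (negPf z0).
rewrite /relay; case: eqP => [|/eqP ja]; first by rewrite scale0r.
case: eqP => [pj|]; last by rewrite scale0r.
by rewrite IH ?scaler0 // (dp ja) pj addSnnS.
Qed.

(** The transposed relay moves data away from the root, and vanishing propagates
    in that direction. *)
Lemma relay_tr_nilpotent v :
  (forall j, \sum_i (relay i j)%:R *: v i = z *: v j) -> forall i, v i = 0.
Proof.
move=> vE i; have := ltnSn (d i); move: {2}(d i).+1 => k.
elim: k i => // k IH i ik.
apply/eqP; have := vE i; rewrite big1 => [/esym/eqP|j _].
  by rewrite scaler_eq0 (negPf z0).
rewrite /relay; case: eqP => [|/eqP ia]; first by rewrite scale0r.
case: eqP => [pi|]; last by rewrite scale0r.
by rewrite IH ?scaler0 // -pi -ltnS -(dp ia).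
Qed.

End Relay.

(** * Block form of the error dynamics *)

Lemma map_mxblock (aT rT : Type) (f : aT -> rT) (m k : nat) (p : 'I_m -> nat)
    (q : 'I_k -> nat) (B : forall i j, 'M[aT]_(p i, q j)) :
  map_mx f (\mxblock_(i, j) B i j) = \mxblock_(i, j) map_mx f (B i j).
Proof. by apply/matrixP => i j; rewrite !mxE. Qed.

Lemma mul_mxblock_mxcol (K : pzRingType) (m k n : nat) (p : 'I_m -> nat)
    (q : 'I_k -> nat) (B : forall i j, 'M[K]_(p i, q j))
    (v : forall j, 'M[K]_(q j, n)) :
  (\mxblock_(i, j) B i j) *m (\mxcol_j v j) = \mxcol_i \sum_j B i j *m v j.
Proof.
rewrite mxblockEh mul_mxrow_mxcol mxcol_sum; apply: eq_bigr => j _.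
by rewrite mxcol_mul.
Qed.

Lemma mxcolZ (K : pzRingType) (m n : nat) (p : 'I_m -> nat) (c : K)
    (v : forall i, 'M[K]_(p i, n)) :
  c *: (\mxcol_i v i) = \mxcol_i (c *: v i).
Proof. by apply/matrixP => i j; rewrite !mxE. Qed.

Lemma error_dynamics_mulE (R : realType) (m n : nat) (r mu : 'I_m -> nat)
    (W : 'M[R]_m) (A : 'M[R]_n) (C : forall i : 'I_m, 'M[R]_(r i, n))
    (H : forall i j : 'I_m, 'M[R]_(n, r j))
    (S : forall i j : 'I_m, 'M[R]_(n, mu j))
    (Q : forall i j : 'I_m, 'M[R]_(mu i, r j))
    (T : forall i j : 'I_m, 'M[R]_(mu i, mu j))
    (eps : 'I_m -> 'cV[R[i]]_n) (aug : forall i, 'cV[R[i]]_(mu i)) :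
  toC (error_dynamics W A C H S Q T)
    *m col_mx (\mxcol_i eps i) (\mxcol_i aug i)
  = col_mx (\mxcol_i (\sum_j (W i j)%:C%C *: (toC A *m eps j)
         - \sum_j toC (H i j) *m (toC (C j) *m eps j)
         - \sum_j toC (S i j) *m aug j))
      (\mxcol_i (\sum_j toC (Q i j) *m (toC (C j) *m eps j)
         + \sum_j toC (T i j) *m aug j)).
Proof.
have CE : toC (block_diag C) *m (\mxcol_i eps i)
    = \mxcol_i (toC (C i) *m eps i).
  rewrite map_mxblock mul_mxblock_mxcol; apply: eq_mxcol => i.
  rewrite (bigD1 i) //= eqxx big1 ?addr0 // => j ji.
  by rewrite eq_sym (negPf ji) map_mx0 mul0mx.
rewrite /error_dynamics map_block_mx mul_block_col kronE.
rewrite !(map_mxB, map_mxN, map_mxM) mulmxBl mulNmx -!mulmxA CE.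
rewrite !map_mxblock !mul_mxblock_mxcol -!mxcolB -mxcolD.
congr col_mx; apply: eq_mxcol => i; congr (_ - _ - _).
by apply: eq_bigr => j _; rewrite map_mxZ -scalemxAl.
Qed.

Lemma error_dynamics_eigen (R : realType) (m n : nat) (r mu : 'I_m -> nat)
    (W : 'M[R]_m) (A : 'M[R]_n) (C : forall i : 'I_m, 'M[R]_(r i, n))
    (H : forall i j : 'I_m, 'M[R]_(n, r j))
    (S : forall i j : 'I_m, 'M[R]_(n, mu j))
    (Q : forall i j : 'I_m, 'M[R]_(mu i, r j))
    (T : forall i j : 'I_m, 'M[R]_(mu i, mu j))
    (z : R[i]) (eps : 'I_m -> 'cV[R[i]]_n) (aug : forall i, 'cV[R[i]]_(mu i)) :
  toC (error_dynamics W A C H S Q T) *m col_mx (\mxcol_i eps i) (\mxcol_i aug i)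
    = z *: col_mx (\mxcol_i eps i) (\mxcol_i aug i)
  <-> (forall i, \sum_j (W i j)%:C%C *: (toC A *m eps j)
         - \sum_j toC (H i j) *m (toC (C j) *m eps j)
         - \sum_j toC (S i j) *m aug j = z *: eps i) /\
      (forall i, \sum_j toC (Q i j) *m (toC (C j) *m eps j)
         + \sum_j toC (T i j) *m aug j = z *: aug i).
Proof.
rewrite error_dynamics_mulE.
rewrite scale_col_mx !mxcolZ; split=> [/eq_col_mx[]|[E1 E2]].
  by move=> /eq_mxcolP E1 /eq_mxcolP E2.
by congr col_mx; apply: eq_mxcol.
Qed.

(** * The plant extended by relays *)

Lemma map_submxcol (aT rT : Type) (f : aT -> rT) (m n : nat) (p : 'I_m -> nat)
    (M : 'M[aT]_(\sum_i p i, n)) i :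
  map_mx f (submxcol M i) = submxcol (map_mx f M) i.
Proof. by apply/matrixP => j k; rewrite !mxE. Qed.

Lemma map_mxcol (aT rT : Type) (f : aT -> rT) (m n : nat) (p : 'I_m -> nat)
    (B : forall i, 'M[aT]_(p i, n)) :
  map_mx f (\mxcol_i B i) = \mxcol_i map_mx f (B i).
Proof. by apply/matrixP => i j; rewrite !mxE. Qed.

Lemma sum_submxrow1 (K : pzRingType) (m n : nat) (p : 'I_m -> nat)
    (u : forall i, 'M[K]_(p i, n)) :
  \sum_i submxrow (1%:M : 'M[K]_(\sum_i p i)) i *m u i = \mxcol_i u i.
Proof. by rewrite -mul_mxrow_mxcol submxrowK mul1mx. Qed.

Lemma map_submxrow1 (aR rR : pzRingType) (f : {rmorphism aR -> rR}) (m : nat)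
    (p : 'I_m -> nat) i :
  map_mx f (submxrow (1%:M : 'M[aR]_(\sum_i p i)) i) = submxrow 1%:M i.
Proof. by rewrite -(map_mx1 f); apply/matrixP => j k; rewrite !mxE. Qed.

(** The coupling W leaves only consensus vectors as unstable modes. *)
Definition consensual (R : realType) (m n : nat) (W : 'M[R]_m) (A : 'M[R]_n) :=
  forall (z : R[i]) (v : 'I_m -> 'cV[R[i]]_n), 1 <= `|z| ->
    (forall i, \sum_j (W i j)%:C%C *: (toC A *m v j) = z *: v i) ->
    forall i j, v i = v j.

Section RelayPlant.
Variables (R : realType) (m n : nat) (r : 'I_m -> nat).
Variables (W : 'M[R]_m) (A : 'M[R]_n) (C : forall i : 'I_m, 'M[R]_(r i, n)).
Variables (a : 'I_m) (d : 'I_m -> nat) (p : 'I_m -> 'I_m).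
Hypothesis dp : forall i, i != a -> d i = (d (p i)).+1.

Let q := (\sum_(i < m) r i)%N.

(** A relay state has room for the outputs of all observers; observer i injects
    its own output into the i-th block of coordinates. *)
Definition relay_input (i j : 'I_m) : 'M[R]_(q, r j) :=
  if i == j then submxrow (1%:M : 'M[R]_q) j else 0.

Definition relay_step (i j : 'I_m) : 'M[R]_q := (relay a p i j)%:R%:M.

Definition relay_plant : 'M[R]_(\sum_(i < m) n + \sum_(i < m) q) :=
  error_dynamics (mu := fun=> q) W A C (fun _ _ => 0) (fun _ _ => 0)
    relay_input relay_step.

(** The centralized controller acts on the error of the root, and observes the
    relay state of the root. *)
Definition root_input : 'M[R]_(\sum_(i < m) n + \sum_(i < m) q, n) :=
  col_mx (submxrow (1%:M : 'M[R]_(\sum_(i < m) n)) a) 0.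

Definition root_output : 'M[R]_(q, \sum_(i < m) n + \sum_(i < m) q) :=
  row_mx 0 (submxcol (1%:M : 'M[R]_(\sum_(i < m) q)) a).

Lemma root_outputE (x : 'cV[R[i]]_(\sum_(i < m) n)) (v : 'I_m -> 'cV[R[i]]_q) :
  toC root_output *m col_mx x (\mxcol_i v i) = v a.
Proof.
rewrite map_row_mx map_mx0 mul_row_col mul0mx add0r map_submxcol map_mx1.
by rewrite submxcol_mul mul1mx mxcolK.
Qed.

Lemma relay_stepE i (v : 'I_m -> 'cV[R[i]]_q) :
  \sum_j toC (relay_step i j) *m v j = \sum_j (relay a p i j)%:R *: v j.
Proof.
apply: eq_bigr => j _.
by rewrite map_scalar_mx mul_scalar_mx /= rmorph_nat.
Qed.

Lemma relay_inputE i (u : forall j, 'cV[R[i]]_(r j)) :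
  \sum_j toC (relay_input i j) *m u j
  = submxrow (1%:M : 'M[R[i]]_q) i *m u i.
Proof.
rewrite (bigD1 i) //= big1 ?addr0 => [|j ji].
  by rewrite /relay_input eqxx map_submxrow1.
by rewrite /relay_input eq_sym (negPf ji) map_mx0 mul0mx.
Qed.

(** Since the relay of the root is zero, relay_telescope says that a combination
    of the injected outputs with nonzero weights vanishes.  They lie in different
    blocks of coordinates, so each output vanishes.  The blocks of the error are
    all equal, so their common value is an unobservable eigenvector of A, which
    detectability excludes; without input the relays vanish too. *)
Lemma relay_plant_detectable :
  (forall i, \sum_j W i j = 1) -> consensual W A ->
  hautus A (\mxcol_i C i) -> hautus relay_plant root_output.
Proof.
move=> W1 consW hAC z x z1.
have z0 : z != 0 by rewrite -normr_gt0 (lt_le_trans ltr01 z1).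
rewrite -[x]vsubmxK -[usubmx x]submxcolK -[dsubmx x]submxcolK.
set eps := submxcol (usubmx x); set rho := submxcol (dsubmx x).
move=> /error_dynamics_eigen[E1 E2]; rewrite root_outputE => rho_a.
have E1' i : \sum_j (W i j)%:C%C *: (toC A *m eps j) = z *: eps i.
  rewrite -E1 [X in _ - X - _]big1 => [|j _]; last by rewrite map_mx0 mul0mx.
  rewrite [X in _ - X]big1 => [|j _]; last by rewrite map_mx0 mul0mx.
  by rewrite !subr0.
have epsE := consW z eps z1 E1'.
pose u i := toC (C i) *m eps i.
have E2' i : submxrow (1%:M : 'M[R[i]]_q) i *m u i
    + \sum_j (relay a p i j)%:R *: rho j = z *: rho i.
  by rewrite -E2 -relay_inputE relay_stepE.
have u0 i : u i = 0.
  have := relay_telescope dp z0 E2'; rewrite rho_a scaler0.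
  under eq_bigr do rewrite scalemxAr.
  rewrite sum_submxrow1 -(mxcol0 _ (p_ := r)) => /eq_mxcolP/(_ i)/eqP.
  by rewrite scaler_eq0 invr_eq0 expf_eq0 (negPf z0) andbF => /eqP.
have rho0 : forall i, rho i = 0.
  by apply: (relay_nilpotent dp z0) => i; rewrite -E2' u0 mulmx0 add0r.
have eps_a : eps a = 0.
  apply: (hAC z) => //.
    rewrite -[RHS]E1'; under eq_bigr => j _ do rewrite (epsE j a).
    by rewrite -scaler_suml -rmorph_sum W1 rmorph1 scale1r.
  rewrite map_mxcol mxcol_mul -(mxcol0 _ (p_ := r)); apply: eq_mxcol => i.
  by rewrite (epsE a i) [LHS]u0.
have eps0 i : eps i = 0 by rewrite (epsE i a).
by rewrite (eq_mxcol eps0) (eq_mxcol rho0) !mxcol0 col_mx0.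
Qed.

(** In a left eigenvector the relay part obeys the transposed relay alone, hence
    vanishes.  The error part is then a left eigenvector of the coupled system,
    so it is a consensus vector, and its block at the root is zero. *)
Lemma relay_plant_stabilizable :
  (forall i j, W i j = W j i) -> consensual W A^T ->
  hautus relay_plant^T root_input^T.
Proof.
move=> Wsym consW z x z1.
have z0 : z != 0 by rewrite -normr_gt0 (lt_le_trans ltr01 z1).
rewrite -[x]vsubmxK -[usubmx x]submxcolK -[dsubmx x]submxcolK.
set eps := submxcol (usubmx x); set rho := submxcol (dsubmx x).
rewrite /relay_plant /error_dynamics tr_block_mx map_block_mx mul_block_col.
rewrite scale_col_mx !mxcolZ => /eq_col_mx[].
rewrite !mxblock0 mul0mx subr0 oppr0 trmx0 map_mx0 mul0mx add0r.
rewrite tr_mxblock map_mxblock mul_mxblock_mxcol => + /eq_mxcolP rhoE.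
have rho0 : forall i, rho i = 0.
  apply: (relay_tr_nilpotent dp z0) => j; rewrite -rhoE; apply: eq_bigr => i _.
  by rewrite /relay_step tr_scalar_mx map_scalar_mx mul_scalar_mx /= rmorph_nat.
rewrite (eq_mxcol rho0) mxcol0 mulmx0 addr0.
rewrite kronE tr_mxblock map_mxblock mul_mxblock_mxcol => /eq_mxcolP epsE.
rewrite /root_input tr_col_mx trmx0 map_row_mx map_mx0 mul_row_col mul0mx addr0.
rewrite tr_submxrow trmx1 map_submxcol map_mx1 submxcol_mul mul1mx mxcolK.
move=> eps_a.
have eps0 i : eps i = 0.
  rewrite -eps_a; apply: (consW z) => // j; rewrite -epsE.
  by apply: eq_bigr => k _; rewrite Wsym linearZ /= map_mxZ -scalemxAl.
by rewrite (eq_mxcol eps0) !mxcol0 col_mx0.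
Qed.
End RelayPlant.

(** * The controller at the root *)

Lemma sum_col_mx (V : nmodType) (m n1 n2 n : nat) (f : 'I_m -> 'M[V]_(n1, n))
    (g : 'I_m -> 'M[V]_(n2, n)) :
  \sum_j col_mx (f j) (g j) = col_mx (\sum_j f j) (\sum_j g j).
Proof.
rewrite -[LHS]vsubmxK !raddf_sum /=; congr col_mx; apply: eq_bigr => j _.
  by rewrite col_mxKu.
by rewrite col_mxKd.
Qed.

Section Network.
Variables (R : realType) (m n : nat) (r : 'I_m -> nat).
Variables (W : 'M[R]_m) (A : 'M[R]_n) (C : forall i : 'I_m, 'M[R]_(r i, n)).
Variables (a : 'I_m) (p : 'I_m -> 'I_m).
Let q := (\sum_(i < m) r i)%N.
Let N := (\sum_(i < m) n + \sum_(i < m) q)%N.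
Variables (K : 'M[R]_(n, N)) (L : 'M[R]_(N, q)) (G : 'M[R]_N).

(** The augmented state of every observer has room for a relay state and for a
    controller state, but the controller gains are nonzero only at the root; the
    controller states of the other observers are reset to 0 at each step. *)
Definition at_root (s t : nat) (M : 'M[R]_(s, t)) (i j : 'I_m) : 'M[R]_(s, t) :=
  if (i == a) && (j == a) then M else 0.

Definition net_S (i j : 'I_m) : 'M[R]_(n, q + N) := row_mx 0 (- at_root K i j).

Definition net_Q (i j : 'I_m) : 'M[R]_(q + N, r j) :=
  col_mx (relay_input R r i j) 0.

Definition net_T (i j : 'I_m) : 'M[R]_(q + N) :=
  block_mx (relay_step R r a p i j) 0 (at_root L i j) (at_root G i j).

Lemma at_rootE (s t : nat) (M : 'M[R]_(s, t)) (v : 'I_m -> 'cV[R[i]]_t) i :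
  \sum_j toC (at_root M i j) *m v j = if i == a then toC M *m v a else 0.
Proof.
rewrite (bigD1 a) //= /at_root eqxx andbT big1 ?addr0 => [|j ja].
  by case: eqP => // _; rewrite map_mx0 mul0mx.
by rewrite (negPf ja) andbF map_mx0 mul0mx.
Qed.

(** An eigenvector of the closed loop restricts to one of the centralized loop:
    errors and relays form the plant state, and the controller state of the root
    the state of the controller.  The other controller states satisfy
    z *: y = 0. *)
Lemma network_schur :
  (forall (z : R[i]) (x y : 'cV[R[i]]_N), 1 <= `|z| ->
    toC (relay_plant W A C a p) *m x + toC (root_input R n r a) *m (toC K *m y)
      = z *: x ->
    toC L *m (toC (root_output R n r a) *m x) + toC G *m y = z *: y ->
    x = 0 /\ y = 0) ->
  schur_stable (error_dynamics (mu := fun=> (q + N)%N) W A C (fun _ _ => 0)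
    net_S net_Q net_T).
Proof.
move=> stable; apply/schur_stableP => z x z1.
have z0 : z != 0 by rewrite -normr_gt0 (lt_le_trans ltr01 z1).
rewrite -[x]vsubmxK -[usubmx x]submxcolK -[dsubmx x]submxcolK.
set eps := submxcol (usubmx x); set aug := submxcol (dsubmx x).
move=> /error_dynamics_eigen[E1 E2].
pose rho i := usubmx (aug i : 'cV_(q + N)).
pose xi i := dsubmx (aug i : 'cV_(q + N)).
have augE i : aug i = col_mx (rho i) (xi i) by rewrite vsubmxK.
have E1' i : \sum_j (W i j)%:C%C *: (toC A *m eps j)
    + (if i == a then toC K *m xi a else 0) = z *: eps i.
  rewrite -E1 [X in _ - X - _]big1 => [|j _]; last by rewrite map_mx0 mul0mx.
  rewrite subr0; congr (_ + _); rewrite -at_rootE -sumrN; apply: eq_bigr => j _.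
  rewrite augE map_row_mx map_mx0 mul_row_col mul0mx add0r.
  by rewrite map_mxN mulNmx opprK.
have E2' i : (\sum_j toC (relay_input R r i j) *m (toC (C j) *m eps j)
      + \sum_j toC (relay_step R r a p i j) *m rho j = z *: rho i) /\
    (if i == a then toC L *m rho a + toC G *m xi a else 0) = z *: xi i.
  have := E2 i.
  have -> : \sum_j toC (net_Q i j) *m (toC (C j) *m eps j) =
      col_mx (\sum_j toC (relay_input R r i j) *m (toC (C j) *m eps j)) 0.
    transitivity (\sum_j col_mx (toC (relay_input R r i j)
        *m (toC (C j) *m eps j)) (0 : 'cV[R[i]]_N)).
      apply: eq_bigr => j _.
      by rewrite map_col_mx map_mx0 mul_col_mx mul0mx.
    by rewrite sum_col_mx big1_eq.
  have -> : \sum_j toC (net_T i j) *m aug j =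
      col_mx (\sum_j toC (relay_step R r a p i j) *m rho j)
       (if i == a then toC L *m rho a + toC G *m xi a else 0).
    transitivity (\sum_j col_mx (toC (relay_step R r a p i j) *m rho j)
        (toC (at_root L i j) *m rho j + toC (at_root G i j) *m xi j)).
      apply: eq_bigr => j _.
      by rewrite augE map_block_mx map_mx0 mul_block_col mul0mx addr0.
    rewrite sum_col_mx big_split /= !at_rootE.
    by case: eqP; rewrite ?addr0.
  by rewrite add_col_mx add0r augE scale_col_mx => /eq_col_mx.
have [X0 xi_a] : col_mx (\mxcol_i eps i) (\mxcol_i rho i) = 0 /\ xi a = 0.
  apply: (stable z) => //; last first.
    by rewrite root_outputE; have [_] := E2' a; rewrite eqxx.
  have -> : toC (root_input R n r a) *m (toC K *m xi a)
      = col_mx (\mxcol_i (if i == a then toC K *m xi a else 0)) 0.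
    rewrite map_col_mx map_mx0 mul_col_mx mul0mx map_submxrow1.
    congr col_mx; rewrite -sum_submxrow1 [RHS](bigD1 a) //= eqxx.
    rewrite [X in _ + X]big1 ?[RHS]addr0 // => i ia.
    by rewrite (negPf ia) mulmx0.
  rewrite error_dynamics_mulE scale_col_mx !mxcolZ add_col_mx addr0 -mxcolD.
  congr col_mx; apply: eq_mxcol => i; last by have [] := E2' i.
  rewrite -E1'; congr (_ + _).
  rewrite [X in _ - X - _]big1 => [|j _]; last by rewrite map_mx0 mul0mx.
  rewrite [X in _ - X]big1 => [|j _]; last by rewrite map_mx0 mul0mx.
  by rewrite !subr0.
have xi0 i : xi i = 0.
  have [_] := E2' i; have [-> //|_] := eqVneq i a.
  by move=> /esym/eqP; rewrite scaler_eq0 (negPf z0) => /eqP.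
move: X0; rewrite -[0]vsubmxK !linear0 => /eq_col_mx[].
rewrite -(mxcol0 _ (p_ := fun=> n)) -(mxcol0 _ (p_ := fun=> q)).
move=> /eq_mxcolP eps0 /eq_mxcolP rho0.
rewrite (eq_mxcol eps0) mxcol0 (eq_mxcol (_ : forall i, aug i = 0)).
  by rewrite mxcol0 col_mx0.
by move=> i; rewrite augE rho0 xi0 col_mx0.
Qed.
End Network.

(** * Sparsity, and the stabilizing network *)

Lemma pattern_le_laplacian (R : realType) (m : nat) (e : rel 'I_m)
    (p q : 'I_m -> nat) (M : forall i j : 'I_m, 'M[R]_(p i, q j)) :
  (forall i j, M i j != 0 -> laplacian R e i j != 0) ->
  pattern_le (pattern M) (pattern (scalar_blocks (laplacian R e))).
Proof.
move=> ML i j; rewrite !mxE; have [//|/ML Lij] := eqVneq (M i j) 0.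
suff -> : scalar_blocks (laplacian R e) i j != 0 by [].
apply: contraNneq Lij; rewrite /scalar_blocks; move: (laplacian R e i j) => x.
by move=> /matrixP/(_ 0 0); rewrite !mxE eqxx mulr1n => ->.
Qed.

(** Some vertex other than i exists; in the tree rooted there, i has a parent,
    and this neighbor differs from i even if e has self-loops. *)
Lemma laplacian_diag_neq0 (R : realType) (m : nat) (e : rel 'I_m)
    (e_sym : symmetric e) (e_conn : forall i j : 'I_m, connect e i j)
    (i : 'I_m) :
  (1 < m)%N -> laplacian R e i i != 0.
Proof.
move=> m1.
have [b ib] : exists b : 'I_m, i != b.
  have /card_gt1P[x [y [_ _ xy]]] : (1 < #|'I_m|)%N by rewrite card_ord.
  by have [->|] := eqVneq i x; [exists y | exists x].
have [d [p /(_ i ib)[eip dp]]] := routing_tree e_sym e_conn b.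
have pi : p i != i by apply: contra_eq_neq dp => ->; rewrite neq_ltn ltnSn.
rewrite mxE eqxx (bigD1 (p i)) //= eip gt_eqF //.
by rewrite ltr_wpDr ?ltr01 // sumr_ge0.
Qed.

Lemma laplacian_edge_neq0 (R : realType) (m : nat) (e : rel 'I_m) (i j : 'I_m) :
  i != j -> e i j -> laplacian R e i j != 0.
Proof. by move=> ij eij; rewrite mxE (negPf ij) eij oppr_eq0 oner_eq0. Qed.

Lemma sum_row_consensus_weights (R : realType) (m : nat) (e : rel 'I_m)
    alpha i :
  \sum_j (1%:M - alpha *: laplacian R e) i j = 1.
Proof.
pose one : 'cV[R]_m := const_mx 1.
have := laplacian_mulE e one i 0; rewrite big1 => [|j _]; last first.
  by rewrite !mxE subrr mulr0.
rewrite mxE => L1.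
have -> : \sum_j (1%:M - alpha *: laplacian R e) i j =
    \sum_j (i == j)%:R - alpha * \sum_j laplacian R e i j * one j 0.
  by rewrite mulr_sumr -sumrB; apply: eq_bigr => j _; rewrite !mxE mulr1.
rewrite L1 mulr0 subr0 (bigD1 i) //= eqxx big1 ?addr0 // => j ji.
by rewrite eq_sym (negPf ji).
Qed.

Theorem mainTheorem1 (R : realType) (m : nat) (hm : (2 < m)%N)
    (e : rel 'I_m) (e_sym : symmetric e)
    (e_conn : forall i j : 'I_m, connect e i j)
    (lam : m.-tuple R) (hlam : ordered_eigenvalues (laplacian R e) lam)
    (n : nat) (A : 'M[R]_n)
    (r : 'I_m -> nat) (C : forall i : 'I_m, 'M[R]_(r i, n))
    (hdet : detectable A (\mxcol_(i < m) C i))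
    (* no restriction when lambda_2 = lambda_m *)
    (hrho : lam`_1 != lam`_m.-1 ->
      spectral_radius A < (lam`_m.-1 + lam`_1) / (lam`_m.-1 - lam`_1))
    (alpha : R) (halpha : 0 < alpha)
    (* no restriction when rho(A) = 0 *)
    (halpha_bounds : spectral_radius A != 0 ->
      (lam`_1)^-1 * (1 - (spectral_radius A)^-1) < alpha
        < (lam`_m.-1)^-1 * (1 + (spectral_radius A)^-1)) :
  exists (mu : 'I_m -> nat)
    (H : forall i j : 'I_m, 'M[R]_(n, r j))
    (S : forall i j : 'I_m, 'M[R]_(n, mu j))
    (Q : forall i j : 'I_m, 'M[R]_(mu i, r j))
    (T : forall i j : 'I_m, 'M[R]_(mu i, mu j)),
    let PL := pattern (scalar_blocks (laplacian R e)) in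
    [/\ pattern_le (pattern H) PL, pattern_le (pattern S) PL,
        pattern_le (pattern Q) PL, pattern_le (pattern T) PL
      & schur_stable
          (error_dynamics (1%:M - alpha *: laplacian R e) A C H S Q T)].
Proof.
have m1 : (1 < m)%N by exact: ltnW.
pose a : 'I_m := Ordinal (ltnW m1).
pose W := 1%:M - alpha *: laplacian R e.
have [d [p tree]] := routing_tree e_sym e_conn a.
have edge i : i != a -> e i (p i) by move=> /tree[].
have dp i : i != a -> d i = (d (p i)).+1 by move=> /tree[].
have contracting (B : 'M[R]_n) : (forall eta, eigenvalue (toC B) eta ->
     eigenvalue (toC A) eta) -> consensual W B.
  move=> BA z v z1 Wv.
  apply: (consensus_eigenvector e_sym e_conn hlam _ z1 Wv) => x eta xlam x0 /BA.
  exact: (contracting_modes m1 e_sym e_conn hlam halpha halpha_bounds).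
have WT : W^T = W by rewrite /W linearB /= trmx1 linearZ /= laplacian_tr.
have Wsym i j : W i j = W j i by rewrite -{1}WT mxE.
have det : hautus (relay_plant W A C a p) (root_output R n r a).
  apply: (relay_plant_detectable dp).
  - exact: sum_row_consensus_weights.
  - exact: contracting.
  - exact: detectable_hautus.
have stab : hautus (relay_plant W A C a p)^T (root_input R n r a)^T.
  apply: (relay_plant_stabilizable dp) => //.
  by apply: contracting => eta; rewrite -map_trmx eigenvalue_tr.
have [K [L [G stable]]] := observer_controller det stab.
have diag i : laplacian R e i i != 0 by exact: laplacian_diag_neq0.
pose q := (\sum_(i < m) r i)%N.
exists (fun=> (q + (\sum_(i < m) n + \sum_(i < m) q))%N).
exists (fun _ _ => 0), (net_S a K), (net_Q R n r), (net_T a p L G).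
split; last exact: network_schur stable.
- by apply: pattern_le_laplacian => i j; rewrite eqxx.
- apply: pattern_le_laplacian => i j; rewrite /net_S /at_root.
  by case: andP => [[/eqP-> /eqP->]|_] //; rewrite oppr0 row_mx0 eqxx.
- apply: pattern_le_laplacian => i j; rewrite /net_Q /relay_input.
  by have [->|_] := eqVneq i j; rewrite ?col_mx0 ?eqxx.
apply: pattern_le_laplacian => i j; rewrite /net_T /at_root /relay_step /relay.
have [/andP[/eqP-> /eqP->] //|_] := boolP ((i == a) && (j == a)).
case: (altP andP) => [[ja /eqP pj]|_] /=; last first.
  by rewrite raddf0 block_mx0 eqxx.
move=> _; apply: laplacian_edge_neq0; last by rewrite e_sym -pj edge.
by rewrite -pj; apply: contra_eq_neq (dp j ja) => ->; rewrite neq_ltn ltnSn.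
Qed.
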